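(* Let $A$ be a commutative ring. The following conditions are equivalent. (1) $A$ satisfies $\mathrm{LocTF}$. (2) For every $P\in\operatorname{Spec}A$ and every ideal $I\subset A$, one has $(I^{\mathrm{reg}})_P=(I_P)^{\mathrm{reg}}$. (3) For every $P\in\operatorname{Spec}A$ and every $\alpha\in\operatorname{Reg}(A_P)$, one has $\alpha A_P\cap\operatorname{Reg}(A)_P\neq\emptyset$. (4) For every $P\in\operatorname{Spec}A$, the natural homomorphism $Q(A)_P\to Q(A_P)$ is an isomorphism.
   Context: All rings are commutative with identity. $\operatorname{Reg}(R)$ is the set of all non-zero-divisors of a ring $R$, and $Q(R)=\operatorname{Reg}(R)^{-1}R$ is its total ring of fractions. For $P\in\operatorname{Spec}A$, $Q(A)_P$ is the localization of $Q(A)$ at the multiplicative set $A\setminus P$, and $\operatorname{Reg}(A)_P=\{c/t\in A_P\mid c\in\operatorname{Reg}(A),\ t\in A\setminus P\}$. The natural map $Q(A)_P\to Q(A_P)$ exists because $A\to A_P$ maps $\operatorname{Reg}(A)$ into $\operatorname{Reg}(A_P)$. An $R$-module $M$ is torsion-free if for every $a\in\operatorname{Reg}(R)$ multiplication by $a$ on $M$ is injective. A ring $A$ satisfies $\mathrm{LocTF}$ if, for every torsion-free $A$-module $M$ and every $P\in\operatorname{Spec}A$, the localization $M_P$ is torsion-free over $A_P$. For an ideal $I$ of a ring $R$, its regular saturation is $I^{\mathrm{reg}}=\{a\in R\mid \text{there exists } b\in\operatorname{Reg}(R)\text{ such that }ab\in I\}$. In (2), $I^{\mathrm{reg}}$ is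 taken in $A$ and $(I_P)^{\mathrm{reg}}$ is taken in $A_P$, where $I_P=IA_P$. *)

(* Defs.v *)
From HB Require Import structures.
From mathcomp Require Import all_boot all_order all_algebra ring.
From mathcomp Require Import boolp classical_sets.

Set Implicit Arguments.
Unset Strict Implicit.
Unset Printing Implicit Defensive.

Import GRing.Theory.

Local Open Scope classical_set_scope.
Local Open Scope quotient_scope.
Local Open Scope ring_scope.

(* Rings are [comPzRingType]s rather than [comNzRingType]s: the zero ring is a
   commutative ring, and a localization may be zero.  For the same reason the
   ideals of ring_quotient.v, which are proper and live in a nonzero ring, are
   not used. *)

Definition is_ideal (R : comPzRingType) (I : set R) : Prop :=
  [/\ I 0, forall x y, I x -> I y -> I (x + y) & forall a x, I x -> I (a * x)].

Record spec (R : comPzRingType) := Spec {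
  spec_set :> set R;
  spec_ideal : is_ideal spec_set;
  spec_proper : ~ spec_set 1;
  spec_prime : forall x y, spec_set (x * y) -> spec_set x \/ spec_set y }.

Definition spec_compl (R : comPzRingType) (P : spec R) : {pred R} :=
  fun x => `[< ~ spec_set P x >].

Lemma spec_complP (R : comPzRingType) (P : spec R) (x : R) :
  reflect (~ spec_set P x) (x \in spec_compl P).
Proof. exact: asboolP. Qed.

Lemma spec_compl_mulr_closed (R : comPzRingType) (P : spec R) :
  mulr_closed (spec_compl P).
Proof.
split; first by apply/spec_complP; exact: spec_proper.
move=> x y /spec_complP Px /spec_complP Py.
by apply/spec_complP => /spec_prime [].
Qed.

HB.instance Definition _ (R : comPzRingType) (P : spec R) :=
  GRing.isMulClosed.Build R (spec_compl P) (spec_compl_mulr_closed P).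

Definition Reg (R : comPzRingType) : {pred R} := fun a => `[< GRing.lreg a >].
Arguments Reg R : clear implicits.

Lemma RegP (R : comPzRingType) (a : R) :
  reflect (forall y, a * y = 0 -> y = 0) (a \in Reg R).
Proof.
apply: (iffP (asboolP _)) => [ra y ay0|]; last exact: mulrI0_lreg.
by apply: ra; rewrite ay0 mulr0.
Qed.

Lemma Reg_mulr_closed (R : comPzRingType) : mulr_closed (Reg R).
Proof.
split; first by apply/asboolP; exact: lreg1.
by move=> x y /asboolP rx /asboolP ry; apply/asboolP; exact: lregM.
Qed.

HB.instance Definition _ (R : comPzRingType) :=
  GRing.isMulClosed.Build R (Reg R) (Reg_mulr_closed R).

Definition torsion_free (R : comPzRingType) (M : lmodType R) : Prop :=
  forall a : R, a \in Reg R -> injective (fun m : M => a *: m).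

(* The localization of the module M at S: classes of pairs (m, s) with s \in S,
   where (m, s) ~ (n, t) iff u *: (t *: m) = u *: (s *: n) for some u \in S. *)
Section LocMod.
Variables (R : comPzRingType) (S : mulrClosed R).

Record denom := Denom { den : R; den_mem : den \in S }.

HB.instance Definition _ := [isSub for den].
HB.instance Definition _ := [Choice of denom by <:].

Definition denom1 : denom := Denom (rpred1 S).
Definition denomM (s t : denom) : denom :=
  Denom (rpredM (den_mem s) (den_mem t)).

Section Carrier.
Variable M : lmodType R.

Definition loceq (x y : M * denom) : bool :=
  `[< exists2 u, u \in S &
        u *: (den y.2 *: x.1) = u *: (den x.2 *: y.1) >].

Lemma loceq_refl : reflexive loceq.
Proof. by move=> x; apply/asboolP; exists 1; rewrite ?rpred1. Qed.

Lemma loceq_sym : symmetric loceq.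
Proof.
by move=> x y; apply/asboolP/asboolP => -[u uS e]; exists u; rewrite // e.
Qed.

Lemma loceq_trans : transitive loceq.
Proof.
move=> [n t] [m s] [p r] /asboolP[/= u uS e] /asboolP[/= v vS f].
apply/asboolP; exists (u * v * den t) => /=.
  by rewrite !rpredM //; exact: den_mem.
rewrite !scalerA in e f *.
have -> : u * v * den t * den r = (v * den r) * (u * den t) by ring.
rewrite -scalerA e scalerA.
have -> : v * den r * (u * den s) = (u * den s) * (v * den r) by ring.
by rewrite -scalerA f scalerA; congr (_ *: _); ring.
Qed.

Canonical loceq_equiv := EquivRel loceq loceq_refl loceq_sym loceq_trans.

Definition locmod := {eq_quot loceq}.

HB.instance Definition _ : EqQuotient _ loceq locmod := EqQuotient.on locmod.
HB.instance Definition _ := Choice.on locmod.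

Definition frac (m : M) (s : denom) : locmod := \pi_locmod (m, s).

Lemma fracP (m n : M) (s t : denom) :
  frac m s = frac n t <->
  exists2 u, u \in S & u *: (den t *: m) = u *: (den s *: n).
Proof.
split=> [/eqmodP /asboolP //|h]; apply/eqmodP; exact/asboolP.
Qed.

Lemma fracW (K : locmod -> Prop) :
  (forall m s, K (frac m s)) -> forall x, K x.
Proof. by move=> h; elim/quotW=> -[m s]; exact: h. Qed.

Lemma frac_repr (x : locmod) : frac (repr x).1 (repr x).2 = x.
Proof. by rewrite /frac -surjective_pairing reprK. Qed.

Definition loc_zero : locmod := frac 0 denom1.

Definition loc_opp : locmod -> locmod :=
  locked (fun x => frac (- (repr x).1) (repr x).2).

Definition loc_add : locmod -> locmod -> locmod := locked (fun x y =>
  frac (den (repr y).2 *: (repr x).1 + den (repr x).2 *: (repr y).1)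
       (denomM (repr x).2 (repr y).2)).

Lemma repr_frac (m : M) (s : denom) :
  exists2 u, u \in S &
    u *: (den s *: (repr (frac m s)).1) = u *: (den (repr (frac m s)).2 *: m).
Proof. by apply/fracP; rewrite frac_repr. Qed.

Lemma loc_oppE (m : M) (s : denom) : loc_opp (frac m s) = frac (- m) s.
Proof.
rewrite /loc_opp -lock.
have [u uS e] := repr_frac m s; apply/fracP; exists u => //.
by rewrite !scalerN e.
Qed.

Lemma loc_addE (m n : M) (s t : denom) :
  loc_add (frac m s) (frac n t) = frac (den t *: m + den s *: n) (denomM s t).
Proof.
rewrite /loc_add -lock.
have [u uS e] := repr_frac m s; have [v vS f] := repr_frac n t.
apply/fracP; exists (u * v); first exact: rpredM.
set p := repr (frac m s) in e *; set q := repr (frac n t) in f *.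
rewrite /= !scalerDr !scalerA in e f *; congr (_ + _).
  have -> : u * v * (den s * den t) * den q.2
          = (v * den t * den q.2) * (u * den s) by ring.
  by rewrite -scalerA e scalerA; congr (_ *: _); ring.
have -> : u * v * (den s * den t) * den p.2
        = (u * den s * den p.2) * (v * den t) by ring.
by rewrite -scalerA f scalerA; congr (_ *: _); ring.
Qed.

Lemma loc_addA : associative loc_add.
Proof.
elim/fracW=> m s; elim/fracW=> n t; elim/fracW=> p r.
rewrite !loc_addE; apply/fracP; exists 1; rewrite ?rpred1 //= !scale1r.
rewrite !scalerDr !scalerA addrA.
by congr (_ *: _ + _ *: _ + _ *: _); ring.
Qed.

Lemma loc_addC : commutative loc_add.
Proof.
elim/fracW=> m s; elim/fracW=> n t; rewrite !loc_addE addrC.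
by apply/fracP; exists 1; rewrite ?rpred1 //= [den t * den s]mulrC.
Qed.

Lemma loc_add0 : left_id loc_zero loc_add.
Proof.
elim/fracW=> m s; rewrite loc_addE; apply/fracP; exists 1; rewrite ?rpred1 //=.
by rewrite !scaler0 !add0r !scale1r mul1r.
Qed.

Lemma loc_addN : left_inverse loc_zero loc_opp loc_add.
Proof.
elim/fracW=> m s; rewrite loc_oppE loc_addE; apply/fracP; exists 1.
  exact: rpred1.
by rewrite scalerN addNr !scaler0.
Qed.

HB.instance Definition _ :=
  GRing.isZmodule.Build locmod loc_addA loc_addC loc_add0 loc_addN.

Lemma fracD (m n : M) (s t : denom) :
  frac m s + frac n t = frac (den t *: m + den s *: n) (denomM s t).
Proof. exact: loc_addE. Qed.

Lemma fracN (m : M) (s : denom) : - frac m s = frac (- m) s.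
Proof. exact: loc_oppE. Qed.

Lemma frac0 (s : denom) : frac 0 s = 0.
Proof. by apply/fracP; exists 1; rewrite ?rpred1 // !scaler0. Qed.

End Carrier.

Definition loc := locmod R^o.

HB.instance Definition _ := GRing.Zmodule.on loc.

Section Scale.
Variable M : lmodType R.

Definition loc_scale : loc -> locmod M -> locmod M := locked (fun x y =>
  frac ((repr x).1 *: (repr y).1 : M) (denomM (repr x).2 (repr y).2)).

Lemma loc_scaleE (a : R^o) (m : M) (s t : denom) :
  loc_scale (frac a s) (frac m t) = frac ((a : R) *: m) (denomM s t).
Proof.
rewrite /loc_scale -lock.
have [u uS e] := repr_frac a s; have [v vS f] := repr_frac m t.
apply/fracP; exists (u * v); first exact: rpredM.
move: e f.
set p := repr (frac a s); set q := repr (frac m t) => e f.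
rewrite /= !scalerA in f *.
have {}e : u * (den s * p.1) = u * (den p.2 * a) := e.
have -> : u * v * (den s * den t) * p.1 = u * (den s * p.1) * (v * den t).
  by ring.
rewrite e -scalerA f scalerA; congr (_ *: _); ring.
Qed.

End Scale.

Definition loc_one : loc := frac (1 : R^o) denom1.

Lemma loc_scaleA (M : lmodType R) (x y : loc) (z : locmod M) :
  loc_scale x (loc_scale y z) = loc_scale (loc_scale x y : loc) z.
Proof.
elim/fracW: x => a s; elim/fracW: y => b t; elim/fracW: z => m r.
rewrite !loc_scaleE scalerA; apply/fracP; exists 1; rewrite ?rpred1 //=.
by congr (_ *: (_ *: _)); rewrite mulrA.
Qed.

Lemma loc_scale1 (M : lmodType R) : left_id loc_one (@loc_scale M).
Proof.
elim/fracW=> m s; rewrite loc_scaleE; apply/fracP; exists 1.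
  exact: rpred1.
by rewrite /= !scale1r mul1r.
Qed.

Lemma loc_scaleDr (M : lmodType R) : right_distributive (@loc_scale M) +%R.
Proof.
elim/fracW=> a s; elim/fracW=> m t; elim/fracW=> n r.
rewrite !(fracD, loc_scaleE); apply/fracP; exists 1; rewrite ?rpred1 //=.
by rewrite !scale1r !scalerDr !scalerA; congr (_ *: _ + _ *: _); ring.
Qed.

Lemma loc_scaleDl (M : lmodType R) (z : locmod M) :
  {morph (@loc_scale M)^~ z : x y / x + y}.
Proof.
elim/fracW: z => m r; elim/fracW=> a s; elim/fracW=> b t.
rewrite !(fracD, loc_scaleE); apply/fracP; exists 1; rewrite ?rpred1 //=.
rewrite !scale1r !scalerDr !scalerDl !scalerDr !scalerA.
by congr (_ *: _ + _ *: _); rewrite /GRing.scale /=; ring.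
Qed.

Lemma loc_mulC : commutative (@loc_scale R^o : loc -> loc -> loc).
Proof.
elim/fracW=> a s; elim/fracW=> b t; rewrite !loc_scaleE.
apply/fracP; exists 1; rewrite ?rpred1 //=.
by rewrite /GRing.scale /=; ring.
Qed.

HB.instance Definition _ := GRing.Zmodule_isComPzRing.Build loc
  (@loc_scaleA R^o) loc_mulC (@loc_scale1 R^o)
  (fun x y z => @loc_scaleDl R^o z x y).

HB.instance Definition _ (M : lmodType R) :=
  GRing.Zmodule_isLmodule.Build loc (locmod M)
    (@loc_scaleA M) (@loc_scale1 M) (@loc_scaleDr M) (@loc_scaleDl M).

Lemma fracZ (M : lmodType R) (a : R) (m : M) (s t : denom) :
  (frac (a : R^o) s : loc) *: frac m t = frac (a *: m) (denomM s t).
Proof. exact: loc_scaleE. Qed.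

Definition fracr (a : R) (s : denom) : loc := frac (a : R^o) s.

Lemma fracrP (a b : R) (s t : denom) :
  fracr a s = fracr b t <->
  exists2 u, u \in S & u * (den t * a) = u * (den s * b).
Proof. exact: fracP. Qed.

Lemma fracrW (K : loc -> Prop) :
  (forall a s, K (fracr a s)) -> forall x, K x.
Proof. by move=> h; apply: (@fracW R^o). Qed.

Lemma fracrD (a b : R) (s t : denom) :
  fracr a s + fracr b t = fracr (den t * a + den s * b) (denomM s t).
Proof. exact: fracD. Qed.

Lemma fracrM (a b : R) (s t : denom) :
  fracr a s * fracr b t = fracr (a * b) (denomM s t).
Proof. exact: loc_scaleE. Qed.

Lemma fracr1 (s : denom) : fracr (den s) s = 1.
Proof. by apply/fracrP; exists 1; rewrite ?rpred1 //= !mul1r mulr1. Qed.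

Definition loc_map (a : R) : loc := fracr a denom1.

Lemma loc_map_is_zmod_morphism : zmod_morphism loc_map.
Proof.
move=> a b; rewrite -[RHS]/(fracr _ _ + - fracr _ _).
have -> : - fracr b denom1 = fracr (- b) denom1 by exact: fracN.
rewrite fracrD; apply/fracrP; exists 1; rewrite ?rpred1 //=; ring.
Qed.

Lemma loc_map_is_monoid_morphism : monoid_morphism loc_map.
Proof.
split=> // a b; rewrite [RHS]fracrM; apply/fracrP; exists 1.
  exact: rpred1.
by rewrite /=; ring.
Qed.

HB.instance Definition _ :=
  GRing.isZmodMorphism.Build R loc loc_map loc_map_is_zmod_morphism.
HB.instance Definition _ :=
  GRing.isMonoidMorphism.Build R loc loc_map loc_map_is_monoid_morphism.

Lemma fracr_mapE (a : R) (s : denom) : fracr a s * loc_map (den s) = loc_map a.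
Proof.
rewrite fracrM; apply/fracrP; exists 1; rewrite ?rpred1 //=; ring.
Qed.

Lemma loc_map_unit (s : R) : s \in S -> exists y, loc_map s * y = 1.
Proof.
move=> sS; exists (fracr 1 (Denom sS)); rewrite fracrM mulr1.
by apply/fracrP; exists 1; rewrite ?rpred1 //=; ring.
Qed.

(* The morphism R_S -> B induced by f : R -> B when f maps S to units of B;
   unitRingType is not available here, as B may be zero. *)
Section Lift.
Variables (B : comPzRingType) (f : {rmorphism R -> B}).
Hypothesis fS : forall s, s \in S -> exists y, f s * y = 1.

Definition loc_lift (x : loc) : B :=
  f (repr x).1 * projT1 (cid (fS (den_mem (repr x).2))).

Lemma loc_liftE (a : R) (s : denom) : loc_lift (fracr a s) * f (den s) = f a.
Proof.
rewrite /loc_lift; case: cid => y /=.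
have [u uS] := repr_frac (a : R^o) s; rewrite -/(fracr a s).
set p := repr _ => e fy; have [z fz] := fS uS.
have {}e : u * (den s * p.1) = u * (den p.2 * a) := e.
have {e} : f u * (f (den s) * f p.1) = f u * (f (den p.2) * f a).
  by rewrite -!rmorphM e.
move=> /(congr1 (fun w => z * y * w)).
have -> : z * y * (f u * (f (den s) * f p.1))
        = (f u * z) * (f p.1 * y * f (den s)) by ring.
have -> : z * y * (f u * (f (den p.2) * f a))
        = (f u * z) * ((f (den p.2) * y) * f a) by ring.
by rewrite fz fy !mul1r.
Qed.

Lemma loc_lift_uniq (a : R) (s : denom) (b : B) :
  b * f (den s) = f a -> loc_lift (fracr a s) = b.
Proof.
have [y fy] := fS (den_mem s).
rewrite -(loc_liftE a s) => /(congr1 ( *%R^~ y)).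
by rewrite -!mulrA fy !mulr1.
Qed.

Lemma loc_lift_is_zmod_morphism : zmod_morphism loc_lift.
Proof.
elim/fracrW=> a s; elim/fracrW=> b t.
have -> : - fracr b t = fracr (- b) t by exact: fracN.
rewrite fracrD; apply: loc_lift_uniq => /=.
by rewrite rmorphD !rmorphM rmorphN -(loc_liftE a s) -(loc_liftE b t); ring.
Qed.

Lemma loc_lift_is_monoid_morphism : monoid_morphism loc_lift.
Proof.
split; first by rewrite -(fracr1 denom1); apply: loc_lift_uniq; rewrite mul1r.
elim/fracrW=> a s; elim/fracrW=> b t; rewrite fracrM.
apply: loc_lift_uniq => /=.
by rewrite !rmorphM -(loc_liftE a s) -(loc_liftE b t); ring.
Qed.

HB.instance Definition _ :=
  GRing.isZmodMorphism.Build loc B loc_lift loc_lift_is_zmod_morphism.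
HB.instance Definition _ :=
  GRing.isMonoidMorphism.Build loc B loc_lift loc_lift_is_monoid_morphism.

Lemma loc_lift_map (a : R) : loc_lift (loc_map a) = f a.
Proof. by apply: loc_lift_uniq; rewrite rmorph1 mulr1. Qed.

End Lift.
End LocMod.

Arguments loc {R} S.
Arguments locmod {R} S M.
Arguments loc_map {R} S a.
Arguments loc_lift {R S B} f fS x.

Section Image.
Variables (R B : comPzRingType) (f : {rmorphism R -> B}) (S : mulrClosed R).

Definition image_mul : {pred B} := fun y => `[< (f @` [set` S]) y >].

Lemma image_mulP (y : B) : reflect (exists2 s, s \in S & f s = y)
  (y \in image_mul).
Proof. exact: asboolP. Qed.

Lemma image_mul_mulr_closed : mulr_closed image_mul.
Proof.
split; first by apply/image_mulP; exists 1; rewrite ?rpred1 ?rmorph1.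
move=> _ _ /image_mulP[s sS <-] /image_mulP[t tS <-].
by apply/image_mulP; exists (s * t); rewrite ?rpredM ?rmorphM.
Qed.

HB.instance Definition _ :=
  GRing.isMulClosed.Build B image_mul image_mul_mulr_closed.

End Image.

Notation localization_at P := (loc (spec_compl P)).
Notation localization_at_mod P M := (locmod (spec_compl P) M).
Notation map_at P := (loc_map (spec_compl P)).
Notation total_frac R := (loc (Reg R)).

Definition LocTF (A : comPzRingType) : Prop :=
  forall M : lmodType A, torsion_free M ->
  forall P : spec A,
    torsion_free (localization_at_mod P M : lmodType (localization_at P)).

Definition regular_saturation (R : comPzRingType) (I : set R) : set R :=
  [set a | exists2 b, b \in Reg R & I (a * b)].

(* I_P = I A_P, the ideal of A_P generated by the image of I. *)
Definition extended_ideal (A : comPzRingType) (P : spec A) (I : set A) :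
    set (localization_at P) :=
  smallest (@is_ideal (localization_at P)) (map_at P @` I).

Arguments extended_ideal {A} P I _.

Definition Reg_at (A : comPzRingType) (P : spec A) : set (localization_at P) :=
  [set x | exists c (t : denom (spec_compl P)), c \in Reg A /\ x = fracr c t].

Arguments Reg_at {A} P _.

Section NaturalMap.
Variables (A : comPzRingType) (P : spec A).

Lemma map_at_Reg (c : A) : c \in Reg A -> map_at P c \in Reg (localization_at P).
Proof.
move=> /RegP rc; apply/RegP; elim/fracrW=> a s.
have f0 : fracr 0 s = 0 :> localization_at P by exact: frac0.
rewrite fracrM -[0]f0 => /fracrP[u uS]; rewrite !mulr0 => e.
apply/fracrP; exists u; rewrite // !mulr0; apply: rc.
by rewrite -[RHS]e; ring.
Qed.

Definition to_total : A -> total_frac (localization_at P) :=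
  loc_map (Reg (localization_at P)) \o map_at P.

HB.instance Definition _ := GRing.RMorphism.on to_total.

Lemma to_total_Reg (c : A) : c \in Reg A -> exists y, to_total c * y = 1.
Proof. by move=> /map_at_Reg; exact: loc_map_unit. Qed.

Definition total_frac_map : total_frac A -> total_frac (localization_at P) :=
  loc_lift to_total to_total_Reg.

HB.instance Definition _ := GRing.RMorphism.on total_frac_map.

(* Q(A)_P, the localization of Q(A) at the image of A \ P in Q(A). *)
Definition total_frac_at : comPzRingType :=
  loc (image_mul (loc_map (Reg A)) (spec_compl P)).

Lemma total_frac_map_unit (q : total_frac A) :
  q \in image_mul (loc_map (Reg A)) (spec_compl P) ->
  exists y, total_frac_map q * y = 1.
Proof.
move=> /image_mulP[t tP <-]; rewrite /total_frac_map loc_lift_map.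
have [y ty] := loc_map_unit tP; exists (loc_map (Reg (localization_at P)) y).
by rewrite /to_total /= -[LHS](rmorphM (loc_map (Reg (localization_at P)))) ty rmorph1.
Qed.

Definition natural_map : total_frac_at -> total_frac (localization_at P) :=
  loc_lift total_frac_map total_frac_map_unit.

HB.instance Definition _ := GRing.RMorphism.on natural_map.

Lemma natural_map_map (a : A) :
  natural_map (loc_map _ (loc_map (Reg A) a)) =
  loc_map (Reg (localization_at P)) (map_at P a).
Proof.
by rewrite /natural_map loc_lift_map /= /total_frac_map loc_lift_map.
Qed.

End NaturalMap.

Arguments natural_map {A} P x.

(* Main.v *)
(** (1) => (2): apply LocTF to the torsion-free module A/I^reg.
    (2) => (3): for alpha = a/s, apply (2) to I = aA; as (I_P)^reg = A_P, some
    t outside P lies in I^reg.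
    (3) => (4): if beta * gamma = c/t with c in Reg(A), then
    x / beta = x gamma t / c; injectivity holds without (3).
    (4) => (1): if 1/alpha is the image of (a/c)/s, then a alpha = c s in A_P,
    so alpha is injective on M_P because c and s are. *)

Require Import Defs.
From HB Require Import structures.
From mathcomp Require Import all_boot all_order all_algebra ring.
From mathcomp Require Import boolp classical_sets.
Import GRing.Theory.
Local Open Scope classical_set_scope.
Local Open Scope ring_scope.

Set Implicit Arguments.
Unset Strict Implicit.
Unset Printing Implicit Defensive.

(* [frac] is otherwise shadowed by the numerator-denominator map of fraction.v. *)
Local Notation frac := Defs.frac.

Section IdealQuotient.
Variables (R : comPzRingType) (I : set R).

(* The proof that [I] is an ideal is an argument only so that the canonical
   [zmodClosed] structure can find it. *)
Definition ideal_pred of is_ideal I : {pred R} := fun x => `[< I x >].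

Variable idI : is_ideal I.

Lemma ideal_pred_zmod_closed : zmod_closed (ideal_pred idI).
Proof.
case: (idI) => I0 ID IM; split; first exact/asboolP.
move=> x y /asboolP Ix /asboolP Iy; apply/asboolP; apply: ID => //.
by rewrite -mulN1r; exact: IM.
Qed.

HB.instance Definition _ :=
  GRing.isZmodClosed.Build R (ideal_pred idI) ideal_pred_zmod_closed.

Definition quotmod := Quotient.quot (ideal_pred idI).

HB.instance Definition _ := GRing.Zmodule.on quotmod.

Definition quotmod_pi (x : R) : quotmod := (\pi_(quotmod) x)%qT.

Lemma quotmod_piW (K : quotmod -> Prop) :
  (forall x, K (quotmod_pi x)) -> forall x, K x.
Proof. by move=> h; elim/quotW. Qed.

Lemma quotmod_piP (x y : R) : quotmod_pi x = quotmod_pi y <-> I (x - y).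
Proof.
split=> [/eqP|Ixy]; first by rewrite -Quotient.idealrBE => /asboolP.
by apply/eqP; rewrite -Quotient.idealrBE; exact/asboolP.
Qed.

Lemma quotmod_piD (x y : R) : quotmod_pi (x + y) = quotmod_pi x + quotmod_pi y.
Proof. exact: Quotient.pi_add. Qed.

Definition quotmod_scale (a : R) : quotmod -> quotmod :=
  locked (fun x => quotmod_pi (a * repr x)).

Lemma quotmod_scaleE (a x : R) :
  quotmod_scale a (quotmod_pi x) = quotmod_pi (a * x).
Proof.
rewrite /quotmod_scale -lock; apply/quotmod_piP; rewrite -mulrBr.
by have [_ _] := idI; apply; apply/quotmod_piP; exact: reprK.
Qed.

Lemma quotmod_scaleA (a b : R) (x : quotmod) :
  quotmod_scale a (quotmod_scale b x) = quotmod_scale (a * b) x.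
Proof. by elim/quotmod_piW: x => x; rewrite !quotmod_scaleE mulrA. Qed.

Lemma quotmod_scale1 : left_id 1 quotmod_scale.
Proof. by elim/quotmod_piW=> x; rewrite quotmod_scaleE mul1r. Qed.

Lemma quotmod_scaleDr : right_distributive quotmod_scale +%R.
Proof.
move=> a; elim/quotmod_piW=> x; elim/quotmod_piW=> y.
by rewrite -quotmod_piD !quotmod_scaleE mulrDr quotmod_piD.
Qed.

Lemma quotmod_scaleDl (x : quotmod) :
  {morph quotmod_scale^~ x : a b / a + b}.
Proof.
elim/quotmod_piW: x => x a b.
by rewrite !quotmod_scaleE mulrDl quotmod_piD.
Qed.

HB.instance Definition _ := GRing.Zmodule_isLmodule.Build R quotmod
  quotmod_scaleA quotmod_scale1 quotmod_scaleDr quotmod_scaleDl.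

Lemma quotmod_piZ (a x : R) : a *: quotmod_pi x = quotmod_pi (a * x).
Proof. exact: quotmod_scaleE. Qed.

Lemma quotmod_pi0 (x : R) : quotmod_pi x = 0 <-> I x.
Proof.
have <- : quotmod_pi 0 = 0 by have := quotmod_piZ 0 0; rewrite scale0r mulr0.
by rewrite quotmod_piP subr0.
Qed.

End IdealQuotient.

Lemma inv_lreg (R : comPzRingType) (u x y : R) :
  (exists v, u * v = 1) -> u * x = u * y -> x = y.
Proof.
by move=> [v uv] /(congr1 ( *%R v)); rewrite !mulrA ![v * _]mulrC uv !mul1r.
Qed.

Lemma inv_mul (R : comPzRingType) (u v : R) :
  (exists x, u * x = 1) -> (exists y, v * y = 1) -> exists z, u * v * z = 1.
Proof.
by move=> [x ux] [y vy]; exists (x * y); rewrite mulrACA ux vy mul1r.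
Qed.

Lemma inv_rmorph (R B : comPzRingType) (f : {rmorphism R -> B}) (u : R) :
  (exists v, u * v = 1) -> exists v, f u * v = 1.
Proof. by move=> [v uv]; exists (f v); rewrite -rmorphM uv rmorph1. Qed.

Section Localization.
Variables (R : comPzRingType) (S : mulrClosed R).

Lemma locmod_frac0 (M : lmodType R) (m : M) (s : denom S) :
  frac m s = 0 <-> exists2 u, u \in S & u *: m = 0.
Proof.
rewrite -(frac0 M (denom1 S)) fracP /=; split=> -[u uS e]; exists u => //.
  by move: e; rewrite scale1r !scaler0.
by rewrite scale1r !scaler0.
Qed.

Lemma loc_mapE (x : loc S) :
  exists a, exists2 s, s \in S & x * loc_map S s = loc_map S a.
Proof.
elim/fracrW: x => a [s sS]; exists a, s => //.
exact: (fracr_mapE a (Denom sS)).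
Qed.

Lemma loc_map0 (a : R) :
  loc_map S a = 0 <-> exists2 u, u \in S & u * a = 0.
Proof. exact: locmod_frac0. Qed.

Lemma loc_map_scale (M : lmodType R) (a : R) (m : M) (s : denom S) :
  loc_map S a *: frac m s = frac (a *: m) s.
Proof.
rewrite fracZ; apply/fracP; exists 1; rewrite ?rpred1 //=.
by rewrite mul1r.
Qed.

End Localization.

Lemma loc_Reg_map_inj (R : comPzRingType) : injective (loc_map (Reg R)).
Proof.
move=> a b /eqP; rewrite -subr_eq0 -rmorphB => /eqP /loc_map0[u /RegP uR e].
by apply/eqP; rewrite -subr_eq0; apply/eqP; exact: uR.
Qed.

Lemma torsion_freeP (R : comPzRingType) (M : lmodType R) :
  torsion_free M <->
  (forall (a : R) (m : M), a \in Reg R -> a *: m = 0 -> m = 0).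
Proof.
split=> [tf a m aR am0|h]; first by apply: (tf a aR); rewrite am0 scaler0.
move=> a aR m n /eqP; rewrite -subr_eq0 -scalerBr => /eqP /h -/(_ aR) /eqP.
by rewrite subr_eq0 => /eqP.
Qed.

Lemma regular_saturation_ideal (R : comPzRingType) (I : set R) :
  is_ideal I -> is_ideal (regular_saturation I).
Proof.
move=> [I0 ID IM]; split.
- by exists 1; rewrite ?rpred1 // mul0r.
- move=> x y [b bR Ib] [c cR Ic]; exists (b * c); first exact: rpredM.
  have -> : (x + y) * (b * c) = c * (x * b) + b * (y * c) by ring.
  by apply: ID; exact: IM.
- by move=> a x [b bR Ib]; exists b => //; rewrite -mulrA; exact: IM.
Qed.

Lemma quotmod_saturation_torsion_free (R : comPzRingType) (I : set R)
    (idJ : is_ideal (regular_saturation I)) :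
  torsion_free (quotmod idJ : lmodType R).
Proof.
apply/torsion_freeP => a; elim/quotmod_piW=> x aR.
rewrite quotmod_piZ => /quotmod_pi0[b bR Ib]; apply/quotmod_pi0.
by exists (a * b); [exact: rpredM | rewrite mulrCA mulrA].
Qed.

Section AtPrime.
Variables (A : comPzRingType) (P : spec A).

Lemma extended_idealP (I : set A) (x : localization_at P) : is_ideal I ->
  extended_ideal P I x <->
  exists2 a, I a & exists s : denom (spec_compl P), x = fracr a s.
Proof.
move=> [I0 ID IM]; split.
  pose J : set (localization_at P) :=
    [set x | exists2 a, I a & exists s, x = fracr a s].
  move=> /(_ J); apply; split; last first.
    by move=> _ [a Ia <-]; exists a => //; exists (denom1 _).
  split.
  - by exists 0 => //; exists (denom1 _).
  - move=> _ _ [a Ia [s ->]] [b Ib [t ->]].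
    exists (den t * a + den s * b); first by apply: ID; exact: IM.
    by rewrite fracrD; eexists.
  - elim/fracrW=> c t _ [a Ia [s ->]].
    by exists (c * a); [exact: IM | rewrite fracrM; eexists].
move=> [a Ia [s ->]] J [[_ _ JM] IJ].
have -> : fracr a s = fracr 1 s * map_at P a.
  by rewrite fracrM; apply/fracrP; exists 1; rewrite ?rpred1 //=; ring.
by apply: JM; apply: IJ; exists a.
Qed.

Lemma extended_ideal_eq0 (I : set A) (idI : is_ideal I) (a : A)
    (s : denom (spec_compl P)) :
  extended_ideal P I (fracr a s) <-> frac (quotmod_pi idI a) s = 0.
Proof.
rewrite extended_idealP // locmod_frac0; split.
  move=> [b Ib [t /fracrP[u uS e]]]; exists (u * den t).
    by rewrite rpredM ?den_mem.
  rewrite quotmod_piZ; apply/quotmod_pi0; rewrite -mulrA e.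
  by have [_ _ IM] := idI; apply/IM/IM.
move=> [u uS]; rewrite quotmod_piZ => /quotmod_pi0 Iua.
exists (u * a) => //; exists (denomM (Denom uS) s); apply/fracrP.
by exists 1; rewrite ?rpred1 //=; ring.
Qed.

Lemma extended_ideal_saturation_sub (I : set A) : is_ideal I ->
  extended_ideal P (regular_saturation I) `<=`
  regular_saturation (extended_ideal P I).
Proof.
move=> idI x /extended_idealP -/(_ (regular_saturation_ideal idI)).
move=> [a [b bR Iab] [s ->]]; exists (map_at P b); first exact: map_at_Reg.
by apply/extended_idealP => //; exists (a * b) => //; rewrite fracrM; eexists.
Qed.

Lemma LocTF_saturation_sub (I : set A) : LocTF A -> is_ideal I ->
  regular_saturation (extended_ideal P I) `<=`
  extended_ideal P (regular_saturation I).
Proof.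
move=> tf idI x [beta rbeta].
have idJ := regular_saturation_ideal idI.
elim/fracrW: beta rbeta => b t rb; elim/fracrW: x => a s.
rewrite fracrM => /extended_idealP -/(_ idI) [c Ic [r e]].
apply/(extended_ideal_eq0 idJ).
have /torsion_freeP := tf _ (@quotmod_saturation_torsion_free _ _ idJ) P.
apply; first exact: rb.
rewrite fracZ quotmod_piZ mulrC.
have -> : denomM t s = denomM s t by apply: val_inj; rewrite /= mulrC.
apply/extended_ideal_eq0; apply/extended_idealP=> //.
exists c; last by exists r.
by exists 1; rewrite ?rpred1 ?mulr1.
Qed.

Lemma saturation_Reg_at :
  (forall I : set A, is_ideal I ->
    regular_saturation (extended_ideal P I) `<=`
    extended_ideal P (regular_saturation I)) ->
  forall alpha : localization_at P, alpha \in Reg (localization_at P) ->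
  range (fun x => alpha * x) `&` Reg_at P !=set0.
Proof.
move=> sat; elim/fracrW=> a s ra.
pose I : set A := range ( *%R a).
have idI : is_ideal I.
  split; first by exists 0; rewrite ?mulr0.
  - by move=> _ _ [x _ <-] [y _ <-]; exists (x + y); rewrite ?mulrDr.
  - by move=> c _ [x _ <-]; exists (c * x); rewrite // mulrCA.
have /(sat I idI) : regular_saturation (extended_ideal P I) 1.
  exists (fracr a s) => //; rewrite mul1r; apply/extended_idealP => //.
  by exists a; [exists 1; rewrite ?mulr1 | exists s].
move=> /extended_idealP -/(_ (regular_saturation_ideal idI)).
move=> [x [b bR [y _ axb]] [t]]; rewrite -(fracr1 t) => /fracrP[u uP e].
exists (map_at P b); split; last by exists b; exists (denom1 _).
exists (fracr (den s * y) t) => //; rewrite fracrM; apply/fracrP.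
exists (u * den t); first by rewrite rpredM ?den_mem.
rewrite /= !mul1r.
have -> : u * den t * (a * (den s * y)) = u * den t * den s * (a * y) by ring.
have -> : u * den t * (den s * den t * b) = den s * b * (u * (den t * den t)).
  by ring.
by rewrite axb e; ring.
Qed.

Definition to_total_frac_at (a : A) : total_frac_at P :=
  loc_map _ (loc_map (Reg A) a).

HB.instance Definition _ := GRing.RMorphism.copy to_total_frac_at
  (loc_map (image_mul (loc_map (Reg A)) (spec_compl P)) \o loc_map (Reg A)).

Lemma natural_map_to_total_frac_at (a : A) :
  natural_map P (to_total_frac_at a) = to_total P a.
Proof. exact: natural_map_map. Qed.

Lemma to_total_eq (a b : A) :
  to_total P a = to_total P b -> map_at P a = map_at P b.
Proof. exact: loc_Reg_map_inj. Qed.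

Lemma to_total_inv (c t : A) :
  c \in Reg A -> t \in spec_compl P -> exists y, to_total P (c * t) * y = 1.
Proof.
move=> cR tP; rewrite rmorphM; apply: inv_mul; first exact: to_total_Reg.
exact: (inv_rmorph (loc_map (Reg (localization_at P))) (loc_map_unit tP)).
Qed.

Lemma to_total_frac_at_inv (c t : A) :
  c \in Reg A -> t \in spec_compl P ->
  exists y, to_total_frac_at (c * t) * y = 1.
Proof.
move=> cR tP; rewrite rmorphM; apply: inv_mul.
  exact: (inv_rmorph (loc_map _) (loc_map_unit cR)).
by apply: loc_map_unit; apply/image_mulP; exists t.
Qed.

Lemma total_frac_atE (x : total_frac_at P) :
  exists a c t, [/\ c \in Reg A, t \in spec_compl P &
    x * to_total_frac_at (c * t) = to_total_frac_at a].
Proof.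
have [q [_ /image_mulP[t tP <-] xt]] := loc_mapE x.
have [a [c cR qc]] := loc_mapE q.
exists a, c, t; split=> //.
rewrite rmorphM mulrCA [X in _ * X]xt mulrC.
by rewrite -[LHS](rmorphM (loc_map _)) qc.
Qed.

Lemma natural_map_inj : injective (natural_map P).
Proof.
apply: raddf_inj => x; have [a [c [t [cR tP xE]]]] := total_frac_atE x.
move=> x0; have /(congr1 (natural_map P)) := xE.
rewrite rmorphM x0 mul0r natural_map_to_total_frac_at -(rmorph0 (to_total P)).
move=> /to_total_eq /esym; rewrite rmorph0 => /loc_map0[u uP ua].
apply: (inv_lreg (to_total_frac_at_inv cR tP)); rewrite mulr0 mulrC xE.
apply: (inv_lreg (to_total_frac_at_inv (rpred1 _) uP)).
by rewrite -rmorphM mul1r ua rmorph0 mulr0.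
Qed.

Lemma natural_map_surj :
  (forall alpha : localization_at P, alpha \in Reg (localization_at P) ->
    range (fun x => alpha * x) `&` Reg_at P !=set0) ->
  forall y, exists x, natural_map P x = y.
Proof.
move=> meet y; have [x [beta rbeta yE]] := loc_mapE y.
have [_ [[gamma _ <-] [c [t [cR e]]]]] := meet _ rbeta.
have {}e : beta * gamma * map_at P (den t) = map_at P c.
  by rewrite e fracr_mapE.
have [a [s sP xE]] := loc_mapE (x * gamma * map_at P (den t)).
have [z cz] := to_total_frac_at_inv cR sP.
exists (to_total_frac_at a * z).
apply: (inv_lreg (to_total_inv cR sP)).
rewrite -!natural_map_to_total_frac_at -rmorphM mulrCA cz mulr1.
rewrite [LHS]natural_map_to_total_frac_at natural_map_to_total_frac_at.
pose f : {rmorphism _ -> _} := loc_map (Reg (localization_at P)).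
have fE b : to_total P b = f (map_at P b) by [].
have csE : map_at P (c * s) = map_at P c * map_at P s by exact: rmorphM.
rewrite !fE csE -e -xE !(rmorphM f) -[f x]yE; ring.
Qed.

Lemma natural_map_bij :
  (forall alpha : localization_at P, alpha \in Reg (localization_at P) ->
    range (fun x => alpha * x) `&` Reg_at P !=set0) ->
  bijective (natural_map P).
Proof.
move=> /natural_map_surj /choice[g gK]; exists g => // x.
exact/natural_map_inj/gK.
Qed.

Lemma natural_map_torsion_free (M : lmodType A) :
  bijective (natural_map P) -> torsion_free M ->
  torsion_free (localization_at_mod P M : lmodType (localization_at P)).
Proof.
move=> [g _ gK] tf; apply/torsion_freeP => alpha m ralpha am0.
have [y ay] := loc_map_unit ralpha.
have [a [c [t [cR tP yE]]]] := total_frac_atE (g y).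
have {}yE : y * to_total P (c * t) = to_total P a.
  by rewrite -!natural_map_to_total_frac_at -[in LHS](gK y) -rmorphM yE.
have cta : map_at P (c * t) = alpha * map_at P a.
  apply: loc_Reg_map_inj; rewrite [RHS]rmorphM.
  by rewrite -[X in _ = _ * X]yE mulrA [X in _ = X * _]ay mul1r.
have : map_at P (c * t) *: m = 0 by rewrite cta mulrC -scalerA am0 scaler0.
elim/fracW: m {am0} => n r; rewrite loc_map_scale => /locmod_frac0[u uP].
rewrite scalerA => e; apply/locmod_frac0; exists (u * t); first exact: rpredM.
apply: (tf c cR); rewrite scaler0 scalerA -[RHS]e; congr (_ *: _); ring.
Qed.

End AtPrime.

Theorem theorem6p3 (A : comPzRingType) :
  [<-> LocTF A;
       forall (P : spec A) (I : set A), is_ideal I ->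
         extended_ideal P (regular_saturation I) =
         regular_saturation (extended_ideal P I);
       forall (P : spec A) (alpha : localization_at P),
         alpha \in Reg (localization_at P) ->
         range (fun x => alpha * x) `&` Reg_at P !=set0;
       forall P : spec A, bijective (natural_map P)].
Proof.
tfae.
- move=> tf P I idI; apply/seteqP; split.
    exact: extended_ideal_saturation_sub.
  exact: LocTF_saturation_sub.
- move=> sat P; apply: saturation_Reg_at => I idI.
  by rewrite sat.
- by move=> meet P; apply: natural_map_bij; exact: meet.
- by move=> bij M tf P; exact: natural_map_torsion_free.
Qed.
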